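(* Let $\Omega\subseteq\mathbf{R}^d$ be a domain with boundary $\Gamma$ and let $d_H$ be the Hausdorff dimension of $\Gamma$. Set $I=(2-(d-d_H),\,2]$. Let $r>0$ and assume that for each $\delta\in I$ there is a $b_{\delta,r}>0$ such that the weighted Hardy inequality $$\|d_\Gamma^{\,\delta/2}\,\nabla\psi\|_2\ \ge\ b_{\delta,r}\,\|d_\Gamma^{\,\delta/2-1}\psi\|_2$$ is valid for all $\psi\in C_c^1(\Gamma_r)$. Let $b_\delta$ be the boundary Hardy constant. Then: I. the function $\delta\in I\mapsto b_\delta+\delta/2$ is non-decreasing, and $b_2\ge b_\delta-(2-\delta)/2$ for all $\delta\in I$; II. if $b_2\ge(d-d_H)/2$ then $|b_2-b_\delta|\le(2-\delta)/2$ for all $\delta\in I$; III. if, in addition to $b_2\ge(d-d_H)/2$, one has $b_\delta\le(d-d_H+\delta-2)/2$ for all $\delta\in I$, then $b_\delta=b_2-(2-\delta)/2$ for all $\delta\in I$.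
   Context: A domain is a connected open set. $d_\Gamma(x)$ is the Euclidean distance from $x$ to $\Gamma$, $\Gamma_r=\{x\in\Omega:d_\Gamma(x)<r\}$ and $\|\cdot\|_2$ is the $L_2(\Omega)$-norm. The boundary Hardy constant is the supremum over all $r>0$ of the possible $b_{\delta,r}$, i.e. $$b_\delta=\sup_{r>0}\ \inf_{0\ne\psi\in C_c^1(\Gamma_r)}\|d_\Gamma^{\,\delta/2}\nabla\psi\|_2\big/\|d_\Gamma^{\,\delta/2-1}\psi\|_2.$$ *)

(* Defs.v *)
From HB Require Import structures.
From mathcomp Require Import all_boot all_order all_algebra.
From mathcomp Require Import all_classical all_reals all_analysis.
Set Implicit Arguments.
Unset Strict Implicit.
Unset Printing Implicit Defensive.
Import Order.TTheory GRing.Theory Num.Theory.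
Import numFieldNormedType.Exports.
Local Open Scope classical_set_scope.
Local Open Scope ring_scope.

(* The product sigma-algebra on row vectors, generated by the coordinate maps,
   following the library's instance for tuples. *)
Section measurable_rowvector.
Context {d : measure_display} {T : measurableType d} (n : nat).

Let coors : 'I_n -> 'rV[T]_n -> T := fun i x => x ord0 i.

Let rV_set0 : g_sigma_preimage coors set0.
Proof. exact: sigma_algebra0. Qed.

Let rV_setC A : g_sigma_preimage coors A -> g_sigma_preimage coors (~` A).
Proof. exact: sigma_algebraC. Qed.

Let rV_bigcup (F : (set 'rV[T]_n)^nat) :
  (forall i, g_sigma_preimage coors (F i)) ->
  g_sigma_preimage coors (\bigcup_i (F i)).
Proof. exact: sigma_algebra_bigcup. Qed.

HB.instance Definition _ := @isMeasurable.Build (measure_tuple_display d)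
  'rV[T]_n (g_sigma_preimage coors) rV_set0 rV_setC rV_bigcup.

End measurable_rowvector.

Lemma measurable_coord d (T : measurableType d) n (i : 'I_n) :
  measurable_fun [set: 'rV[T]_n] (fun x : 'rV[T]_n => x ord0 i).
Proof.
move=> _ Y mY; rewrite setTI; apply: sub_sigma_algebra => /=.
rewrite -bigcup_seq/=; exists i => /=; first by rewrite mem_index_enum.
by exists Y => //; rewrite setTI.
Qed.

Lemma measurable_fun_rVP d1 d2 (T1 : measurableType d1)
    (T2 : measurableType d2) n (f : T1 -> 'rV[T2]_n) :
  (forall i, measurable_fun [set: T1] (fun x => f x ord0 i)) ->
  measurable_fun [set: T1] f.
Proof.
move=> mf _ A mA; rewrite setTI.
suff: g_sigma_preimage (fun i x => f x ord0 i) `<=` @measurable _ T1.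
  apply; rewrite (_ : (fun i x => _) =
    (fun i => (fun v : 'rV[T2]_n => v ord0 i) \o f)) //.
  by rewrite g_sigma_preimage_comp; exists A => //; rewrite setTI.
apply: smallest_sub; first exact: sigma_algebra_measurable.
case: n => [|n] in f mf A mA *; first by rewrite big_ord0.
rewrite -bigcup_mkord_ord; apply: bigcup_sub => i Ii.
by move=> B [C mC <-]; exact: mf.
Qed.

Section lebesgue_measure_rV.
Variable R : realType.

Definition cons_rV n (p : measurableTypeR R * 'rV[R]_n) : 'rV[R]_n.+1 :=
  row_mx (const_mx (p.1 : R)) p.2 : 'rV[R]_(1 + n).

Definition uncons_rV n (v : 'rV[R]_n.+1) : measurableTypeR R * 'rV[R]_n :=
  (v ord0 ord0, rsubmx (v : 'rV[R]_(1 + n))).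

Lemma cons_rV0 n p : @cons_rV n p ord0 ord0 = p.1.
Proof.
rewrite (_ : ord0 = lshift n (ord0 : 'I_1)); last exact: val_inj.
by rewrite /cons_rV (@row_mxEl _ 1 1 n) mxE.
Qed.

Lemma cons_rVS n p i : @cons_rV n p ord0 (lift ord0 i) = p.2 ord0 i.
Proof.
rewrite (_ : lift ord0 i = rshift 1 i); last exact: val_inj.
by rewrite /cons_rV (@row_mxEr _ 1 1 n).
Qed.

Lemma uncons_rVS n v i : (@uncons_rV n v).2 ord0 i = v ord0 (lift ord0 i).
Proof. by rewrite /= mxE; congr (v _ _); exact: val_inj. Qed.

Lemma cons_rVK n : cancel (@cons_rV n) (@uncons_rV n).
Proof.
case=> x v; rewrite /uncons_rV cons_rV0; congr pair.
apply/rowP => i; rewrite -[RHS]/((x, v).2 ord0 i) -cons_rVS -uncons_rVS.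
by [].
Qed.

Lemma uncons_rVK n : cancel (@uncons_rV n) (@cons_rV n).
Proof.
move=> v; apply/rowP => i.
by case: (unliftP ord0 i) => [j|] ->; rewrite ?cons_rV0 ?cons_rVS ?uncons_rVS.
Qed.

Lemma measurable_cons_rV n : measurable_fun setT (@cons_rV n).
Proof.
apply: measurable_fun_rVP => i; rewrite /cons_rV.
under eq_fun do rewrite mxE.
case: (splitP (i : 'I_(1 + n))) => j _.
  by under eq_fun do rewrite mxE; exact: measurable_fst.
apply: (@measurableT_comp _ _ _ _ _ _ (fun v : 'rV[R]_n => v ord0 j)) => //.
exact: measurable_coord.
Qed.

Lemma measurable_uncons_rV n : measurable_fun setT (@uncons_rV n).
Proof.
apply/measurable_fun_pairP; split; first exact: measurable_coord.
apply: measurable_fun_rVP => i; rewrite /uncons_rV /=.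
under eq_fun do rewrite mxE.
exact: (@measurable_coord _ R n.+1).
Qed.

Definition lebesgue_cons n (mu : {sigma_finite_measure set 'rV[R]_n -> \bar R})
  : set 'rV[R]_n.+1 -> \bar R :=
  pushforward (lebesgue_measure \x mu)%E (@cons_rV n).

Section lebesgue_cons_measure.
Variables (n : nat) (mu : {sigma_finite_measure set 'rV[R]_n -> \bar R}).

Let pf : {measure set 'rV[R]_n.+1 -> \bar R} :=
  measure_function_pushforward__canonical__measure_function_Measure
    (lebesgue_measure \x mu)%E (@measurable_cons_rV n).

HB.instance Definition _ := isMeasure.Build _ _ _ (lebesgue_cons mu)
  (measure0 pf) (measure_ge0 pf) (@measure_semi_sigma_additive _ _ _ pf).

Let lebesgue_cons_sigma_finite : sigma_finite setT (lebesgue_cons mu).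
Proof.
have /sigma_finiteP[F [TF ndF Foo]] :=
  sigma_finiteT (@lebesgue_measure R : {sigma_finite_measure set _ -> \bar R}).
have /sigma_finiteP[G [TG ndG Goo]] := sigma_finiteT mu.
exists (fun k => @uncons_rV n @^-1` (F k `*` G k)).
  apply/seteqP; split => // v _.
  have [i _ Fi] : (\bigcup_k F k) (@uncons_rV n v).1 by rewrite -TF.
  have [j _ Gj] : (\bigcup_k G k) (@uncons_rV n v).2 by rewrite -TG.
  exists (maxn i j) => //; split.
    by move: Fi; exact/subsetPset/ndF/leq_maxl.
  by move: Gj; exact/subsetPset/ndG/leq_maxr.
move=> k; have [mF Fkoo] := Foo k; have [mG Gkoo] := Goo k; split.
  rewrite -[X in measurable X]setTI; apply: measurable_uncons_rV => //.
  exact: measurableX.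
rewrite /lebesgue_cons /pushforward -comp_preimage.
rewrite (_ : _ \o _ = id); last by apply/funext => p /=; rewrite cons_rVK.
by rewrite preimage_id product_measure1E// lte_mul_pinfty// ge0_fin_numE.
Qed.

HB.instance Definition _ := Measure_isSigmaFinite.Build _ _ _
  (lebesgue_cons mu) lebesgue_cons_sigma_finite.

End lebesgue_cons_measure.

(* Lebesgue measure on R^n, as the n-fold product of [lebesgue_measure];
   see [lebesgue_rV_box]. *)
Fixpoint lebesgue_rV n : {sigma_finite_measure set 'rV[R]_n -> \bar R} :=
  if n is m.+1 then lebesgue_cons (lebesgue_rV m) else @dirac _ 'rV[R]_0 0 R.

Lemma lebesgue_rV_box n (A : 'I_n -> set R) :
  (forall i, measurable (A i)) ->
  lebesgue_rV n [set x | forall i, A i (x ord0 i)] =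
  (\prod_(i < n) lebesgue_measure (A i))%E.
Proof.
elim: n A => [|n IH] A mA.
  rewrite big_ord0 /= diracE mem_set //= => -[] //.
have mB : measurable [set x : 'rV[R]_n | forall i, A (lift ord0 i) (x ord0 i)].
  rewrite (_ : mkset _ = \bigcap_(i in setT)
    ((fun x : 'rV[R]_n => x ord0 i) @^-1` A (lift ord0 i))); last first.
    by apply/seteqP; split => [x h i _|x h i]; [exact: h|exact: (h i I)].
  apply: fin_bigcap_measurable => // i _.
  by rewrite -[X in measurable X]setTI; exact: measurable_coord.
rewrite big_ord_recl -IH // -product_measure1E //=.
rewrite /lebesgue_cons /pushforward; congr (product_measure1 _ _ _).
apply/seteqP; split => [p /= h|p /= [h1 h2] i].
  by split => [|i]; [rewrite -cons_rV0|rewrite -cons_rVS].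
by case: (unliftP ord0 i) => [j|] ->; rewrite ?cons_rV0 ?cons_rVS.
exact: (mA ord0).
Qed.

End lebesgue_measure_rV.

Section euclidean.
Variables (R : realType) (d : nat).
Implicit Types (x y : 'rV[R]_d) (A U : set 'rV[R]_d).

(* The library norm on 'rV[R]_d is the sup norm; it defines the same topology
   and the same derivatives, but distances and gradient lengths below must be
   Euclidean. *)
Definition enorm x : R := Num.sqrt (\sum_(i < d) x ord0 i ^+ 2).

(* Meaningful only for [A] nonempty. *)
Definition edistance A x : R := inf [set enorm (x - y) | y in A].

Definition boundary U := closure U `\` interior U.

Definition is_domain U := open U /\ connected U.

Definition gradient (psi : 'rV[R]_d -> R) x : 'rV[R]_d :=
  \row_(i < d) 'D_(delta_mx ord0 i) psi x.

Definition C1 (psi : 'rV[R]_d -> R) :=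
  (forall x, differentiable psi x) /\ continuous (gradient psi).

Definition csupport (psi : 'rV[R]_d -> R) := closure [set x | psi x != 0].

(* C_c^1(U), functions being extended by zero outside U. *)
Definition Cc1 U : set ('rV[R]_d -> R) :=
  [set psi | [/\ C1 psi, compact (csupport psi) & csupport psi `<=` U]].

Definition L2norm U (f : 'rV[R]_d -> R) : \bar R :=
  ('N[lebesgue_rV R d]_2%:E [EFin \o (f \_ U)])%E.

End euclidean.

Section hausdorff_dimension.
Variables (R : realType) (d : nat).
Implicit Types (A U : set 'rV[R]_d).
Local Open Scope ereal_scope.

(* Equal to -oo on the empty set. *)
Definition ediam U : \bar R :=
  ereal_sup [set (enorm (p.1 - p.2))%:E | p in U `*` U].

(* (diam U)^s, with the usual conventions 0^0 = 1 and zero weight for the empty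
   set. *)
Definition diam_pow (s : R) U : \bar R :=
  if `[< U = set0 >] then 0 else ediam U `^ s.

Definition hausdorff_premeasure (s eps : R) A : \bar R :=
  ereal_inf [set \sum_(i <oo) diam_pow s (U i) | U in
    [set U : (set 'rV[R]_d)^nat |
      A `<=` \bigcup_i U i /\ forall i, ediam (U i) <= eps%:E]].

Definition hausdorff_measure (s : R) A : \bar R :=
  ereal_sup [set hausdorff_premeasure s eps A | eps in [set eps | (0 < eps)%R]].

Definition hausdorff_dim A : \bar R :=
  ereal_inf [set s%:E | s in [set s | (0 <= s)%R /\ hausdorff_measure s A = 0]].

End hausdorff_dimension.

Section hardy.
Variables (R : realType) (d : nat) (Omega : set 'rV[R]_d).

Definition bdist (x : 'rV[R]_d) : R := edistance (boundary Omega) x.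

Definition boundary_layer (r : R) : set 'rV[R]_d :=
  [set x | Omega x /\ bdist x < r].

Definition hardy_gradient_norm (delta : R) (psi : 'rV[R]_d -> R) : \bar R :=
  L2norm Omega (fun x => bdist x `^ (delta / 2) * enorm (gradient psi x)).

Definition hardy_weight_norm (delta : R) (psi : 'rV[R]_d -> R) : \bar R :=
  L2norm Omega (fun x => bdist x `^ (delta / 2 - 1) * psi x).

Definition hardy_inequality (delta r b : R) : Prop :=
  forall psi, Cc1 (boundary_layer r) psi ->
    (b%:E * hardy_weight_norm delta psi <= hardy_gradient_norm delta psi)%E.

Definition boundary_hardy_constant (delta : R) : \bar R :=
  ereal_sup [set ereal_inf
      [set (hardy_gradient_norm delta psi / hardy_weight_norm delta psi)%E
        | psi in [set psi | Cc1 (boundary_layer r) psi /\ psi <> cst 0]]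
    | r in [set r : R | 0 < r]].

(* The interval I = (2 - (d - d_H), 2]. *)
Definition hardy_range : set R :=
  [set delta | (2%:E - (d%:R%:E - hausdorff_dim (boundary Omega))
                  < delta%:E <= 2%:E)%E].

End hardy.

(* Main.v *)
Require Import Defs.
From HB Require Import structures.
From mathcomp Require Import all_boot all_order all_algebra.
From mathcomp Require Import all_classical all_reals all_analysis.
From mathcomp Require Import measurable_realfun ring lra.
Set Implicit Arguments.
Unset Strict Implicit.
Unset Printing Implicit Defensive.
Import Order.TTheory GRing.Theory Num.Theory.
Import numFieldNormedType.Exports.
Local Open Scope classical_set_scope.
Local Open Scope ring_scope.

(* If phi is a test function for delta2 and a = (delta2 - delta1) / 2, then
   dist^a phi is one for delta1, up to smoothness: the weights satisfy
   dist^(delta1/2 - 1) dist^a |phi| = dist^(delta2/2 - 1) |phi|, and as the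
   distance is 1-Lipschitz the product rule costs at most
   |a| dist^(delta2/2 - 1) |phi| in the gradient term.  Hence
   b_delta1 <= b_delta2 + |delta2 - delta1| / 2 for all real exponents, which
   gives I, and also II once b_2 is finite; III follows.  To stay in C^1 the
   distance is replaced by the soft minimum of finitely many distances to
   boundary points, which on the compact support of phi is comparable to dist
   with constants close to 1 and still has gradient of length at most 1.  The
   constant b_2 is finite since bumps supported in balls B(c, dist(c) / 2) with
   c close to the boundary have a bounded Hardy quotient, by scaling. *)

(** * The Euclidean norm on row vectors and its comparison with the sup norm *)

Section euclidean_norm.
Variables (R : realType) (d : nat).
Implicit Types (x y : 'rV[R]_d) (A U : set 'rV[R]_d).

Lemma sum_sqr_ge0 x : 0 <= \sum_(i < d) x ord0 i ^+ 2.
Proof. by apply: sumr_ge0 => i _; exact: sqr_ge0. Qed.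

Lemma enorm_ge0 x : 0 <= enorm x.
Proof. exact: sqrtr_ge0. Qed.

Lemma sqr_enorm x : enorm x ^+ 2 = \sum_(i < d) x ord0 i ^+ 2.
Proof. by rewrite sqr_sqrtr// sum_sqr_ge0. Qed.

Lemma enormZ a x : enorm (a *: x) = `|a| * enorm x.
Proof.
rewrite /enorm -sqrtr_sqr -sqrtrM ?sqr_ge0//; congr Num.sqrt.
by rewrite mulr_sumr; apply: eq_bigr => i _; rewrite mxE exprMn.
Qed.

Lemma enormN x : enorm (- x) = enorm x.
Proof. by rewrite -scaleN1r enormZ normrN1 mul1r. Qed.

Lemma enorm0 : enorm (0 : 'rV[R]_d) = 0.
Proof. by rewrite -(scale0r 0) enormZ normr0 mul0r. Qed.

Lemma enormB x y : enorm (x - y) = enorm (y - x).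
Proof. by rewrite -enormN opprB. Qed.

Lemma ler_coord_enorm x i : `|x ord0 i| <= enorm x.
Proof.
rewrite -sqrtr_sqr ler_sqrt ?sum_sqr_ge0//.
by rewrite (bigD1 i)//= lerDl; apply: sumr_ge0 => j _; exact: sqr_ge0.
Qed.

Lemma enorm_eq0 x : enorm x = 0 -> x = 0.
Proof.
move=> x0; apply/rowP => i; rewrite mxE; apply/eqP.
by rewrite -normr_le0 -x0 ler_coord_enorm.
Qed.

Lemma ler_enormD x y : enorm (x + y) <= enorm x + enorm y.
Proof.
have [x0|x0] := eqVneq (enorm x) 0.
  by rewrite (enorm_eq0 x0) add0r enorm0 add0r.
have [y0|y0] := eqVneq (enorm y) 0.
  by rewrite (enorm_eq0 y0) addr0 enorm0 addr0.
have px : 0 < enorm x by rewrite lt_def x0 enorm_ge0.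
have py : 0 < enorm y by rewrite lt_def y0 enorm_ge0.
rewrite -(@ler_pXn2r _ 2) ?nnegrE ?addr_ge0 ?enorm_ge0//.
rewrite sqr_enorm.
(* Weighted AM-GM in each coordinate: 2 a b <= (Y/X) a^2 + (X/Y) b^2. *)
set X := enorm x in x0 px *; set Y := enorm y in y0 py *.
apply: (@le_trans _ _ (\sum_(i < d)
    ((1 + Y / X) * x ord0 i ^+ 2 + (1 + X / Y) * y ord0 i ^+ 2))).
  apply: ler_sum => i _; rewrite mxE.
  set a := x _ _; set b := y _ _.
  have -> : (1 + Y / X) * a ^+ 2 + (1 + X / Y) * b ^+ 2 =
      (a + b) ^+ 2 + (Y * a - X * b) ^+ 2 / (X * Y).
    by field; rewrite x0 y0.
  by rewrite lerDl divr_ge0 ?sqr_ge0// mulr_ge0// ltW.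
rewrite big_split/= -!mulr_sumr -!sqr_enorm -/X -/Y le_eqVlt; apply/orP; left.
by apply/eqP; field; rewrite x0 y0.
Qed.

Lemma enorm_distD x y z : enorm (x - z) <= enorm (x - y) + enorm (y - z).
Proof. by rewrite -[x - z](subrKA y) ler_enormD. Qed.

Lemma ler_norm_enorm x : `|x| <= enorm x.
Proof.
have [->|x0] := eqVneq x 0; first by rewrite normr0 enorm0.
have /mx_norm_neq0[[i j] /= xE] : mx_norm x != 0 by rewrite -[_ x]/`|x| normr_eq0.
by rewrite -[`|x|]/(mx_norm x) xE ord1 ler_coord_enorm.
Qed.

Lemma ler_coord_norm x i : `|x ord0 i| <= `|x|.
Proof.
rewrite -[`|x|]/(mx_norm x) mx_normrE.
by apply: (le_bigmax _ (fun ij => `|x ij.1 ij.2|) (ord0, i)).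
Qed.

Lemma enorm_ler_norm x : enorm x <= d%:R * `|x|.
Proof.
rewrite -[leRHS]ger0_norm ?mulr_ge0// -sqrtr_sqr ler_sqrt ?sqr_ge0//.
apply: (@le_trans _ _ (\sum_(i < d) `|x| ^+ 2)).
  apply: ler_sum => i _; rewrite -(real_normK (num_real _)).
  by rewrite ler_pXn2r ?nnegrE//; exact: ler_coord_norm.
rewrite sumr_const card_ord exprMn -[leLHS]mulr_natl ler_wpM2r ?sqr_ge0//.
by rewrite -natrX ler_nat; case: (d) => // n; rewrite leq_pmulr.
Qed.

(** The one-sided bound gives both signs by exchanging x and y, and the Euclidean norm is at most d
    times the sup norm, which defines the topology. *)
Lemma enorm_lipschitz_continuous (f : 'rV[R]_d -> R) :
  (forall x y, f x <= f y + enorm (x - y)) -> continuous f.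
Proof.
move=> fk x; apply/(cvgrPdist_lt (FF := nbhs_filter x)) => e e0.
(* With [d + 1] in place of [d] the radius is positive also for d = 0. *)
have M0 : 0 < d%:R + 1 :> R by rewrite ltr_wpDl.
apply/nbhs_ballP; exists (e / (d%:R + 1)); rewrite /= ?divr_gt0// => y.
rewrite -ball_normE /ball_/=.
rewrite ltr_pdivlMr// => /(le_lt_trans _); apply.
apply: (@le_trans _ _ (enorm (x - y))).
  have := fk x y; have := fk y x; rewrite (enormB y x) ler_norml.
  by move=> *; lra.
by apply: le_trans (enorm_ler_norm _) _; rewrite mulrC ler_wpM2l// lerDl.
Qed.

Lemma continuous_enorm : continuous (@enorm R d).
Proof.
by apply: enorm_lipschitz_continuous => x y; rewrite addrC -{1}[x](subrK y) ler_enormD.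
Qed.

End euclidean_norm.

(** * The distance to a nonempty set *)

Section euclidean_distance.
Variables (R : realType) (d : nat) (A : set 'rV[R]_d).
Hypothesis A0 : A !=set0.
Implicit Types x y : 'rV[R]_d.

Let inf_dist x : has_inf [set enorm (x - y) | y in A].
Proof.
split; first by case: A0 => y Ay; exists (enorm (x - y)); exists y.
by exists 0 => _ [y _ <-]; exact: enorm_ge0.
Qed.

Lemma edistance_le x y : A y -> edistance A x <= enorm (x - y).
Proof. by move=> Ay; apply: ge_inf; [case: (inf_dist x)|exists y]. Qed.

Lemma edistance_ge x e : (forall y, A y -> e <= enorm (x - y)) ->
  e <= edistance A x.
Proof.
move=> Ae; apply: lb_le_inf; first by case: (inf_dist x).
by move=> _ [y Ay <-]; exact: Ae.
Qed.

Lemma edistance_ge0 x : 0 <= edistance A x.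
Proof. by apply: edistance_ge => y _; exact: enorm_ge0. Qed.

Lemma edistance_adherent x e : edistance A x < e ->
  exists2 y, A y & enorm (x - y) < e.
Proof.
rewrite -subr_gt0 => /(inf_adherent)/(_ (inf_dist x))[_ [y Ay <-]].
rewrite -/(edistance A x) [ltRHS]addrC subrK => ?.
by exists y.
Qed.

Lemma edistance_lipschitz x y : edistance A x <= edistance A y + enorm (x - y).
Proof.
rewrite -lerBlDr; apply: edistance_ge => z Az; rewrite lerBlDr.
by rewrite (le_trans (edistance_le _ Az))// [leRHS]addrC enorm_distD.
Qed.

Lemma continuous_edistance : continuous (edistance A).
Proof. exact: enorm_lipschitz_continuous edistance_lipschitz. Qed.

(** U contains a sup-norm ball around x, hence the Euclidean ball of the same radius, and no point
    of A lies in it. *)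
Lemma edistance_gt0 U x : open U -> U x -> U `&` A = set0 -> 0 < edistance A x.
Proof.
move=> oU Ux UA; have /nbhs_ballP[e /= e0 xeU] := open_nbhs_nbhs (conj oU Ux).
apply: (lt_le_trans e0); apply: edistance_ge => y Ay.
rewrite leNgt; apply/negP => xye.
have Uy : U y.
  apply: xeU; rewrite -ball_normE /ball_/=.
  exact: le_lt_trans (ler_norm_enorm _) xye.
by have : (U `&` A) y by []; rewrite UA.
Qed.

End euclidean_distance.

(** * Gradients and C^1 functions *)

Section gradient_calculus.
Variables (R : realType) (d : nat).
Implicit Types (f g : 'rV[R]_d -> R) (x y : 'rV[R]_d).

Lemma gradientD f g x : differentiable f x -> differentiable g x ->
  gradient (f \+ g) x = gradient f x + gradient g x.
Proof.
move=> df dg; apply/rowP => i; rewrite !mxE.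
by rewrite (deriveD (f := f) (g := g))//; exact: diff_derivable.
Qed.

Lemma gradientM f g x : differentiable f x -> differentiable g x ->
  gradient (f \* g) x = f x *: gradient g x + g x *: gradient f x.
Proof.
move=> df dg; apply/rowP => i; rewrite !mxE.
by rewrite (deriveM (f := f) (g := g))//; exact: diff_derivable.
Qed.

Lemma gradient_comp (h : R -> R) f x (h' : R) : differentiable f x ->
  is_derive (f x) 1 h h' ->
  differentiable (h \o f) x /\ gradient (h \o f) x = h' *: gradient f x.
Proof.
move=> df [dh hE].
have {}dh : differentiable h (f x) by exact/derivable1_diffP.
have dhf : differentiable (h \o f) x by exact: differentiable_comp.
split=> //; apply/rowP => i; rewrite !mxE deriveE// deriveE//.
by rewrite diff_comp//= diff1E// derive1E hE /GRing.scale/= mulrC.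
Qed.

Lemma gradient_cst k x : gradient (cst k : 'rV[R]_d -> R) x = 0.
Proof. by apply/rowP => i; rewrite !mxE derive_cst. Qed.

Lemma derive_coord x v i : 'D_v (fun y : 'rV[R]_d => y ord0 i) x = v ord0 i.
Proof.
rewrite deriveE; last exact: differentiable_coord.
have cf : continuous (fun y : 'rV[R]_d => y ord0 i) by exact: coord_continuous.
have lf : linear (fun y : 'rV[R]_d => y ord0 i) by move=> a u w; rewrite !mxE.
pose L := GRing.isLinear.Build _ _ _ _ _ lf.
pose l : {linear 'rV[R]_d -> R^o} := HB.pack (fun y : 'rV[R]_d => y ord0 i) L.
by rewrite (diff_lin x (f := l)).
Qed.

(** The squared norm is a sum of squares of affine functions, which avoids the square root and its
    singularity at y. *)
Lemma gradient_sqr_enorm y x :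
  differentiable (fun z => enorm (z - y) ^+ 2) x /\
  gradient (fun z => enorm (z - y) ^+ 2) x = 2 *: (x - y).
Proof.
pose l i : 'rV[R]_d -> R := fun z => z ord0 i - y ord0 i.
have -> : (fun z => enorm (z - y) ^+ 2) = \sum_(i < d) (l i * l i).
  apply/funext => z; rewrite fct_sumE sqr_enorm.
  by apply: eq_bigr => i _; rewrite !mxE expr2.
have dl i z : differentiable (l i) z.
  by apply: differentiableB => //; exact: differentiable_coord.
have dll i z : differentiable (l i * l i) z by exact: differentiableM.
have lE i v : 'D_v (l i) x = v ord0 i.
  rewrite deriveB ?derive_coord ?derive_cst ?subr0//.
  exact/diff_derivable/differentiable_coord.
split; first exact: differentiable_sum.
apply/rowP => j; rewrite !mxE derive_sum => [|i]; last exact: diff_derivable.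
rewrite (bigD1 j)//= big1 ?addr0 => [|i ij];
  rewrite deriveM ?lE ?mxE ?eqxx; try exact: diff_derivable.
  by rewrite /GRing.scale/= mulr1 mulr2n mulrDl mul1r.
by rewrite /= (negbTE ij) /GRing.scale/= mulr0 addr0.
Qed.

Lemma C1D f g : C1 f -> C1 g -> C1 (f \+ g).
Proof.
move=> [df cf] [dg cg]; split.
  by move=> x; apply: differentiableD.
rewrite (_ : gradient _ = gradient f \+ gradient g).
  by move=> x; exact: (cvgD (cf x) (cg x)).
by apply/funext => x; rewrite gradientD.
Qed.

Lemma C1_continuous f : C1 f -> continuous f.
Proof. by move=> [df _] x; exact: differentiable_continuous. Qed.

Lemma C1M f g : C1 f -> C1 g -> C1 (f \* g).
Proof.
move=> Cf Cg; have [[df cf] [dg cg]] := (Cf, Cg); split.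
  by move=> x; apply: differentiableM.
rewrite (_ : gradient _ = fun x => f x *: gradient g x + g x *: gradient f x).
  move=> x; apply: (cvgD (cvgZ _ (cg x)) (cvgZ _ (cf x)));
    exact: C1_continuous.
by apply/funext => x; rewrite gradientM.
Qed.

(** The hypotheses on h concern only values of f, so that real powers of positive functions are
    covered. *)
Lemma C1_comp (h h' : R -> R) f : C1 f -> (forall x, is_derive (f x) 1 h (h' (f x))) ->
  (forall x, {for f x, continuous h'}) -> C1 (h \o f).
Proof.
move=> Cf hf h'f; have [df cf] := Cf.
split; first by move=> x; have [] := gradient_comp (df x) (hf x).
rewrite (_ : gradient _ = fun x => h' (f x) *: gradient f x).
  move=> x; apply: (cvgZ _ (cf x)).
  by apply: continuous_comp; [exact: C1_continuous|exact: h'f].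
by apply/funext => x; have [] := gradient_comp (df x) (hf x).
Qed.

Lemma C1_powR f c : C1 f -> (forall x, 0 < f x) -> C1 (fun x => f x `^ c).
Proof.
move=> Cf f0.
apply: (@C1_comp (@powR R ^~ c) (fun t => c * t `^ (c - 1))) => // x.
  exact: is_derive1_powR.
have [/derivable1_diffP/differentiable_continuous cp _] :=
  is_derive1_powR (c - 1) (f0 x).
exact: (cvgM (cvg_cst c) cp).
Qed.

Lemma gradient_powR f c x : differentiable f x -> 0 < f x ->
  gradient (fun x => f x `^ c) x = (c * f x `^ (c - 1)) *: gradient f x.
Proof. 
move=> df f0.
by have [] := gradient_comp df (is_derive1_powR c f0).
Qed.

Lemma C1_cst k : C1 (cst k : 'rV[R]_d -> R).
Proof.
split; first by move=> x; exact: differentiable_cst.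
rewrite (_ : gradient _ = cst 0); first exact: cst_continuous.
by apply/funext => x; rewrite gradient_cst.
Qed.

Lemma C1_sqr_enorm y : C1 (fun z => enorm (z - y) ^+ 2).
Proof.
split; first by move=> x; have [] := gradient_sqr_enorm y x.
rewrite (_ : gradient _ = fun x => 2 *: (x - y)).
  move=> x; apply: differentiable_continuous.
  apply: differentiableZ; apply: differentiableB.
    exact: ex_diff.
  exact: differentiable_cst.
by apply/funext => x; have [] := gradient_sqr_enorm y x.
Qed.

End gradient_calculus.

(** * Smooth approximation of the distance on compact sets *)

Section regularized_distance.
Variables (R : realType) (d : nat).
Implicit Types (x y : 'rV[R]_d) (p : 'rV[R]_d * R) (ys : seq ('rV[R]_d * R)).

Lemma ler_powRN (x y r : R) : 0 <= r -> 0 < x -> x <= y ->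
  y `^ (- r) <= x `^ (- r).
Proof.
move=> r0 x0 xy; have y0 := lt_le_trans x0 xy.
rewrite !powRN lef_pV2 ?posrE ?powR_gt0//.
by rewrite ge0_ler_powR ?nnegrE// ltW.
Qed.

Lemma ler_enorm_sum (I : Type) (s : seq I) (f : I -> 'rV[R]_d) :
  enorm (\sum_(i <- s) f i) <= \sum_(i <- s) enorm (f i).
Proof.
elim: s => [|i s IH]; first by rewrite !big_nil enorm0.
by rewrite !big_cons (le_trans (ler_enormD _ _))// lerD2l.
Qed.

Lemma C1_sum (I : eqType) (s : seq I) (f : I -> 'rV[R]_d -> R) :
  (forall i, i \in s -> C1 (f i)) ->
  C1 (fun x => \sum_(i <- s) f i x) /\
  forall x, gradient (fun x => \sum_(i <- s) f i x) x =
            \sum_(i <- s) gradient (f i) x.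
Proof.
elim: s => [|i s IH] Cf.
  under eq_fun do rewrite big_nil; split; first exact: C1_cst.
  by move=> x; rewrite big_nil; exact: gradient_cst.
have Ci : C1 (f i) by apply: Cf; rewrite mem_head.
have [Cs gs] : C1 (fun x => \sum_(i <- s) f i x) /\
  forall x, gradient (fun x => \sum_(i <- s) f i x) x =
            \sum_(i <- s) gradient (f i) x.
  by apply: IH => j js; apply: Cf; rewrite inE js orbT.
under eq_fun do rewrite big_cons.
split; first exact: (C1D Ci Cs).
move=> x; rewrite big_cons -gs.
by apply: gradientD; [exact: Ci.1|exact: Cs.1].
Qed.

Definition sqdist p x : R := enorm (x - p.1) ^+ 2 + p.2.

Lemma sqdist_gt0 p x : 0 < p.2 -> 0 < sqdist p x.
Proof. by move=> p0; rewrite ltr_wpDl ?sqr_ge0. Qed.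

Lemma C1_sqdist p : C1 (sqdist p).
Proof. exact: (C1D (C1_sqr_enorm p.1) (C1_cst _ p.2)). Qed.

Lemma gradient_sqdist p x : gradient (sqdist p) x = 2 *: (x - p.1).
Proof.
have [dn gn] := gradient_sqr_enorm p.1 x.
have := gradientD dn (differentiable_cst p.2 x).
by rewrite gn gradient_cst addr0.
Qed.

(* The l^q soft minimum of the distances sqrt (|x - y|^2 + tau) to the points
   y; the shifts tau > 0 make it smooth at these points too. *)
Definition softmin q ys x : R :=
  (\sum_(p <- ys) sqdist p x `^ (- q)) `^ (- (2 * q)^-1).

Section softmin.
Variables (q : R) (ys : seq ('rV[R]_d * R)).
Hypotheses (q0 : 0 < q) (ys_gt0 : forall p, p \in ys -> 0 < p.2).
Hypothesis ys0 : (0 < size ys)%N.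

Let S x := \sum_(p <- ys) sqdist p x `^ (- q).

Let S_ge p x : p \in ys -> sqdist p x `^ (- q) <= S x.
Proof.
move=> pys; rewrite /S (big_rem p)//= lerDl.
by apply: sumr_ge0 => r _; exact: powR_ge0.
Qed.

Let S_gt0 x : 0 < S x.
Proof.
case: ys ys_gt0 S_ge ys0 => // p s s0 Sp _.
apply: lt_le_trans (Sp p x _); last by rewrite mem_head.
by rewrite powR_gt0// sqdist_gt0// s0// mem_head.
Qed.

Lemma softmin_gt0 x : 0 < softmin q ys x.
Proof. by rewrite powR_gt0// S_gt0. Qed.


Let C1_S : C1 S /\ forall x, gradient S x =
  \sum_(p <- ys) gradient (fun x => sqdist p x `^ (- q)) x.
Proof.
apply: C1_sum => p pys; apply: C1_powR; first exact: C1_sqdist.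
by move=> x; apply: sqdist_gt0; exact: ys_gt0.
Qed.

Lemma C1_softmin : C1 (softmin q ys).
Proof. by apply: C1_powR; [exact: C1_S.1|exact: S_gt0]. Qed.

(** With N = |x - y|^2 + tau, each summand has a gradient of length 2q N^(-q-1) |x - y|, where |x -
    y| <= N^(1/2) and N^(-1/2) = (N^(-q))^(1/(2q)) <= S^(1/(2q)). *)
Let enorm_gradient_S x :
  enorm (gradient S x) <= 2 * q * (S x * S x `^ (2 * q)^-1).
Proof.
rewrite C1_S.2 (le_trans (ler_enorm_sum _ _))// mulrA mulr_sumr mulr_suml.
rewrite big_seq [leRHS]big_seq; apply: ler_sum => p pys.
have p0 := sqdist_gt0 x (ys_gt0 pys).
rewrite gradient_powR//; last exact: (C1_sqdist p).1.
rewrite gradient_sqdist scalerA enormZ.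
have -> : `|- q * sqdist p x `^ (- q - 1) * 2| =
    2 * q * (sqdist p x `^ (- q) * sqdist p x `^ (- 1)).
  rewrite -powRD ?(gt_eqF p0) ?implybT// !normrM normrN.
  rewrite (gtr0_norm q0) (ger0_norm (powR_ge0 _ _)) ger0_norm//.
  by ring.
rewrite -!mulrA ler_wpM2l// ler_wpM2l ?(ltW q0)// ler_wpM2l ?powR_ge0//.
apply: (@le_trans _ _ ((sqdist p x `^ (- q)) `^ (2 * q)^-1)); last first.
  by rewrite ge0_ler_powR ?nnegrE ?powR_ge0 ?S_ge ?invr_ge0 ?mulr_ge0// ltW// S_gt0.
have -> : (sqdist p x `^ (- q)) `^ (2 * q)^-1 = sqdist p x `^ (- 2^-1).
  by rewrite -powRrM; congr (_ `^ _); field; rewrite gt_eqF.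
rewrite (powR_inv1 (ltW p0)) powRN (powR12_sqrt (ltW p0)).
rewrite [leLHS]mulrC ler_pdivrMr// -[X in _ <= _ * X]sqr_sqrtr ?(ltW p0)//.
rewrite expr2 mulKf ?sqrtr_eq0 -?ltNge//.
by rewrite -[leLHS]ger0_norm ?enorm_ge0// -sqrtr_sqr ler_sqrt ?(ltW p0)// lerDl (ltW (ys_gt0 pys)).
Qed.

(** With c = 1/(2q), the chain rule multiplies the bound on the gradient of S by c S^(-c-1), and all
    powers of S cancel. *)
Lemma enorm_gradient_softmin x : enorm (gradient (softmin q ys) x) <= 1.
Proof.
have c0 : 0 < (2 * q)^-1 by rewrite invr_gt0 mulr_gt0.
rewrite gradient_powR ?S_gt0//; last exact: C1_S.1.1.
rewrite -/(S x) enormZ normrM normrN (gtr0_norm c0) (ger0_norm (powR_ge0 _ _)).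
have k0 : 0 <= (2 * q)^-1 * S x `^ (- (2 * q)^-1 - 1).
  by rewrite mulr_ge0 ?powR_ge0// ltW.
apply: (le_trans (ler_wpM2l k0 (enorm_gradient_S x))).
have s0 := S_gt0 x; set s := S x in s0 *; set c := (2 * q)^-1.
have -> : c * s `^ (- c - 1) * (2 * q * (s * s `^ c)) =
    s `^ (- c - 1) * s `^ 1 * s `^ c.
  by rewrite (powRr1 (ltW s0)) /c; field; rewrite gt_eqF.
rewrite -!powRD ?(gt_eqF s0) ?implybT//.
by rewrite (_ : _ + _ = 0) ?powRr0//; ring.
Qed.

(** The one nearby point bounds the sum from below, which gives the upper estimate. Conversely the
    sum has [size ys] terms of size at most e^(-2q), and the power -1/(2q) turns their number into a
    factor at least 1/k. *)
Lemma softmin_bounds (k e : R) x : 0 < e -> 1 < k ->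
  (size ys)%:R <= k `^ (2 * q) ->
  (forall p, p \in ys -> e ^+ 2 <= sqdist p x) ->
  (exists2 p, p \in ys & sqdist p x <= (k * e) ^+ 2) ->
  e / k <= softmin q ys x <= k * e.
Proof.
move=> e0 k1 mk He [p pys pe].
have k0 : 0 < k by exact: lt_trans k1.
have c0 : 0 < (2 * q)^-1 by rewrite invr_gt0 mulr_gt0.
have sq0 (t : R) : 0 < t -> ((t ^+ 2) `^ (- q)) `^ (- (2 * q)^-1) = t.
  move=> t0; rewrite -powR_mulrn ?ltW// -!powRrM.
  rewrite -[RHS]powRr1 ?ltW//; congr (_ `^ _).
  by field; rewrite gt_eqF.
apply/andP; split; last first.
  rewrite -(sq0 (k * e)) ?mulr_gt0// ler_powRN ?(ltW c0)//.
    by rewrite powR_gt0// exprn_gt0// mulr_gt0.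
  apply: le_trans (S_ge x pys).
  by rewrite ler_powRN ?(ltW q0)// sqdist_gt0// ys_gt0.
have kk : k^-1 = (k `^ (2 * q)) `^ (- (2 * q)^-1).
  rewrite -powRrM -powR_inv1 ?ltW//; congr (_ `^ _).
  by field; rewrite gt_eqF.
rewrite mulrC -(sq0 e)// kk -powRM ?powR_ge0// ler_powRN ?(ltW c0) ?S_gt0//.
apply: (@le_trans _ _ (\sum_(p <- ys) (e ^+ 2) `^ (- q))).
  rewrite big_seq [leRHS]big_seq; apply: ler_sum => r rys.
  by rewrite ler_powRN ?(ltW q0) ?He// exprn_gt0.
rewrite big_const_seq count_predT iter_addr_0 -[leLHS]mulr_natl.
by rewrite ler_wpM2r ?powR_ge0.
Qed.

End softmin.


Lemma open_lt_fun (T : topologicalType) (f g : T -> R) :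
  continuous f -> continuous g -> open [set x | f x < g x].
Proof.
move=> cf cg; rewrite (_ : mkset _ = (g \- f) @^-1` [set t | 0 < t]).
  apply: open_comp; last exact: open_gt.
  by move=> x _; exact: (cvgB (cg x) (cf x)).
by apply/seteqP; split => x /=; rewrite subr_gt0.
Qed.

(** For each x in K some point of A has shifted distance below k dist(x). This is an open condition
    in x, so finitely many points serve all of K; a large q then offsets their number. *)
Lemma regularized_distance (A K : set 'rV[R]_d) (k : R) : A !=set0 ->
  compact K -> (forall x, K x -> 0 < edistance A x) -> 1 < k ->
  exists D : 'rV[R]_d -> R, [/\ C1 D, forall x, 0 < D x,
    forall x, enorm (gradient D x) <= 1 &
    forall x, K x -> edistance A x / k <= D x <= k * edistance A x].
Proof.
move=> A0 cK K0 k1; have k0 : 0 < k by exact: lt_trans k1.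
pose Y : set ('rV[R]_d * R) := [set p | A p.1 /\ 0 < p.2].
pose U p := [set x | sqdist p x < (k * edistance A x) ^+ 2].
have cE := continuous_edistance A0.
have oU p : Y p -> open (U p).
  move=> _; apply: open_lt_fun.
    exact: C1_continuous (C1_sqdist p).
  move=> x; apply: (@continuous_comp _ _ _ _ (fun t : R => (k * t) ^+ 2)).
    exact: cE.
  apply: (@continuous_comp _ _ _ _ (fun t : R => t ^+ 2)).
    exact: mulrl_continuous.
  exact: exprn_continuous.
have KU : K `<=` cover Y U.
  move=> x Kx; have e0 := K0 x Kx.
  have /edistance_adherent[//|y Ay xy] : edistance A x < k * edistance A x.
    by rewrite ltr_pMl.
  have xy2 : enorm (x - y) ^+ 2 < (k * edistance A x) ^+ 2.
    by rewrite ltr_pXn2r ?nnegrE ?enorm_ge0// mulr_ge0 ?ltW.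
  (* The shift is half the gap, so the inequality defining [U] stays strict. *)
  exists (y, ((k * edistance A x) ^+ 2 - enorm (x - y) ^+ 2) / 2).
    by split => //=; rewrite divr_gt0// subr_gt0.
  by rewrite /U /sqdist/=; lra.
move: cK; rewrite compact_cover => /(_ _ Y U oU KU)[D' D'Y KD'].
have [y Ay] := A0.
(* The extra point makes the list nonempty even if K is empty; it lies in A and so respects the
   lower bound on [sqdist]. *)
pose ys := (y, 1) :: finmap.enum_fset D'.
have ysY p : p \in ys -> Y p.
  by rewrite inE => /predU1P[->|/D'Y]; [split => //=|rewrite inE].
have ys_gt0 p : p \in ys -> 0 < p.2 by move=> /ysY[].
(* Chosen so that k^(2q) is k^2 times the number of points; the summand 1 keeps q positive for a
   single point. *)
pose q : R := ln (size ys)%:R / (2 * ln k) + 1.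
have lnk : 0 < ln k by exact: ln_gt0.
have q0 : 0 < q.
  by rewrite ltr_wpDl// divr_ge0 ?mulr_ge0 ?(ltW lnk)// ln_ge0// ler1n.
have ysk : (size ys)%:R <= k `^ (2 * q).
  rewrite -ler_ln ?posrE ?powR_gt0 ?ltr0n// ln_powR.
  have -> : 2 * q * ln k = ln (size ys)%:R + 2 * ln k.
    by rewrite /q; field; rewrite gt_eqF.
  by rewrite lerDl mulr_ge0// ltW.
exists (softmin q ys); split.
- exact: C1_softmin.
- by move=> x; exact: softmin_gt0.
- by move=> x; exact: enorm_gradient_softmin.
move=> x Kx; apply: softmin_bounds => //; first exact: K0.
- move=> p /ysY[Ap p0]; rewrite /sqdist.
  rewrite (@le_trans _ _ (enorm (x - p.1) ^+ 2))//; last by rewrite lerDl ltW.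
  by rewrite ler_pXn2r ?nnegrE ?enorm_ge0 ?edistance_ge0// edistance_le.
- have [p /= D'p Up] := KD' x Kx; exists p; last exact: ltW.
  by rewrite inE; apply/orP; right.
Qed.

End regularized_distance.

(** * Borel measurability for the product sigma-algebra *)

Section borel_rowvectors.
Variables (R : realType) (d : nat).
Implicit Types (U : set 'rV[R]_d) (f g : 'rV[R]_d -> R).

Lemma measurable_box (A : 'I_d -> set R) : (forall i, measurable (A i)) ->
  measurable [set x : 'rV[R]_d | forall i, A i (x ord0 i)].
Proof.
move=> mA; rewrite (_ : mkset _ = \bigcap_(i in setT)
    ((fun x : 'rV[R]_d => x ord0 i) @^-1` A i)); last first.
  by apply/seteqP; split => [x h i _|x h i]; [exact: h|exact: (h i I)].
apply: fin_bigcap_measurable => // i _.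
by rewrite -[X in measurable X]setTI; exact: measurable_coord.
Qed.

(** U is the countable union of the open cubes with rational centre and half-side 1/(n+1) that it
    contains, and cubes are measurable boxes. *)
Lemma open_measurable_rV U : open U -> measurable U.
Proof.
move=> oU.
pose B (cn : 'rV[rat]_d * nat) := [set x : 'rV[R]_d |
  forall i, `]ratr (cn.1 ord0 i) - cn.2.+1%:R^-1,
              ratr (cn.1 ord0 i) + cn.2.+1%:R^-1[%classic (x ord0 i)].
have -> : U = \bigcup_cn (if `[< B cn `<=` U >] then B cn else set0).
  apply/seteqP; split => [x Ux|x [cn _]]; last first.
    by case: ifPn => // /asboolP; apply.
  have /nbhs_ballP[e /= e0 xeU] := open_nbhs_nbhs (conj oU Ux).
  have e2 : 0 < e / 2 by rewrite divr_gt0.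
  (* Half of e, since two points of a cube of half-side r differ by less than 2r in each
     coordinate. *)
  have [n _ /(_ n (leqnn n))/= ne] :=
    near_infty_natSinv_lt (PosNum e2).
  set r := n.+1%:R^-1 in ne.
  have r0 : 0 < r by rewrite invr_gt0.
  have cP i : exists c : rat, ratr c \in `](x ord0 i) - r, (x ord0 i) + r[.
    by apply: rat_in_itvoo; rewrite ltrD2l gtrN.
  pose c : 'rV[rat]_d := \row_i projT1 (cid (cP i)).
  have cE i : `|x ord0 i - ratr (c ord0 i)| < r.
    rewrite mxE; case: cid => q /=; rewrite in_itv/= => /andP[? ?].
    by rewrite ltr_norml; apply/andP; split; lra.
  have xB : B (c, n) x.
    move=> i; have := cE i; rewrite /= in_itv/= ltr_norml -/r => /andP[? ?].
    by apply/andP; split; lra.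
  exists (c, n) => //; rewrite ifT//; apply/asboolP => z Bz.
  apply: xeU; rewrite -ball_normE /ball_/=.
  have [->|xz] := eqVneq x z; first by rewrite subrr normr0.
  have /mx_norm_neq0[[i j] /= zE] : mx_norm (x - z) != 0.
    by rewrite -[mx_norm _]/`|x - z| normr_eq0 subr_eq0.
  rewrite -[`|x - z|]/(mx_norm (x - z)) zE ord1 !mxE.
  have := Bz j; have := cE j.
  rewrite /= in_itv/= -/r ltr_norml => /andP[? ?] /andP[? ?].
  by rewrite ltr_norml; apply/andP; split; lra.
apply: countable_bigcupT_measurable => // cn.
case: ifPn => // _; apply: (@measurable_box
  (fun i => `]ratr (cn.1 ord0 i) - cn.2.+1%:R^-1,
             ratr (cn.1 ord0 i) + cn.2.+1%:R^-1[%classic)) => i.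
exact: measurable_itv.
Qed.

Lemma continuous_measurable_rV f : continuous f -> measurable_fun setT f.
Proof.
move=> /continuousP cf; apply: (measurability _ (RGenOpens.measurableE R)).
move=> _ [_ [a [b ->] <-]]; rewrite setTI; apply: open_measurable_rV.
exact/cf/interval_open.
Qed.

End borel_rowvectors.

(** * Monotonicity and triangle inequality for the L_2-norm *)

Section L2norm.
Variables (R : realType) (d : nat) (U : set 'rV[R]_d).
Hypothesis mU : measurable U.
Implicit Types f g : 'rV[R]_d -> R.
Local Open Scope ereal_scope.

Lemma L2norm_le f g (k : R) : (0 <= k)%R ->
  measurable_fun setT f -> measurable_fun setT g ->
  (forall x, U x -> `|g x| <= k * `|f x|)%R ->
  L2norm U g <= k%:E * L2norm U f.
Proof.
move=> k0 mf mg gf.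
have mfU : measurable_fun setT (f \_ U).
  by apply/(measurable_restrictT _ mU); exact: measurable_funTS.
have mgU : measurable_fun setT (g \_ U).
  by apply/(measurable_restrictT _ mU); exact: measurable_funTS.
have m2 (h : 'rV[R]_d -> R) : measurable_fun setT h ->
    measurable_fun [set: 'rV[R]_d] (fun x => `|(h x)%:E| `^ 2).
  move=> mh; apply: (measurableT_comp (measurable_poweR 2)).
  by apply: measurableT_comp => //; exact/measurable_EFinP.
rewrite /L2norm unlock.
(* Under the square root k becomes the factor k^2 of the integral. *)
have -> : k%:E = (k `^ 2)%:E `^ 2^-1.
  by rewrite poweR_EFin -powRrM mulfV// powRr1.
rewrite -poweRM ?lee_fin ?powR_ge0//; last by apply: integral_ge0 => x _; exact: poweR_ge0.
rewrite -ge0_integralZl_EFin ?powR_ge0//; [|by move=> *; exact: poweR_ge0|exact: (m2 _ mfU)].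
apply: gt0_ler_poweR; rewrite ?in_itv/= ?andbT ?leey ?integral_ge0//.
  by move=> x _; rewrite -EFinM lee_fin mulr_ge0 ?powR_ge0.
apply: ge0_le_integral => //.
- exact: (m2 _ mgU).
- by apply: measurable_funeM; exact: (m2 _ mfU).
- move=> x _; rewrite -EFinM lee_fin -powRM//.
  rewrite ge0_ler_powR ?nnegrE ?mulr_ge0// !patchE.
  by case: ifPn => [/[!inE]/gf//|_]; rewrite !normr0 mulr0.
Qed.

Lemma L2normD f g : measurable_fun setT f -> measurable_fun setT g ->
  L2norm U (f \+ g)%R <= L2norm U f + L2norm U g.
Proof.
move=> mf mg; rewrite /L2norm.
have -> : (f \+ g)%R \_ U = ((f \_ U) \+ (g \_ U))%R.
  by apply/funext => x; rewrite /= !patchE; case: ifPn => // _; rewrite addr0.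
apply: minkowski_EFin => //; last by rewrite ler1n.
  by apply/(measurable_restrictT _ mU); exact: measurable_funTS.
by apply/(measurable_restrictT _ mU); exact: measurable_funTS.
Qed.

Lemma L2norm_ge0 f : 0 <= L2norm U f.
Proof. exact: Lnorm_ge0. Qed.

End L2norm.

(** * Transfer of test functions between two weights *)

Section hardy_transfer.
Variables (R : realType) (d : nat) (Omega : set 'rV[R]_d).
Hypothesis domain_Omega : is_domain Omega.
Hypothesis boundary_neq0 : boundary Omega !=set0.
Implicit Types (phi psi : 'rV[R]_d -> R) (delta r : R).

Lemma bdist_gt0 x : Omega x -> 0 < bdist Omega x.
Proof.
have [oO _] := domain_Omega => Ox.
apply: (edistance_gt0 boundary_neq0 oO Ox).
apply/seteqP; split => // y [Oy [_]]; apply.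
by move: (oO); rewrite openE; apply.
Qed.

(** The complement of the support is open, so psi vanishes near x and its partial derivatives at x
    are those of 0. *)
Lemma notin_csupport psi x : ~ csupport psi x -> psi x = 0 /\ gradient psi x = 0.
Proof.
move=> /= Kx; have oK : open (~` csupport psi).
  by apply: closed_openC; exact: closed_closure.
have K0 y : (~` csupport psi) y -> psi y = 0.
  move=> Ky; apply/eqP; apply: contra_notT Ky => psiy.
  exact: subset_closure.
split; first exact: K0.
apply/rowP => i; rewrite !mxE (@near_eq_derive _ _ _ _ (cst 0)) ?derive_cst//.
by apply: filterS (open_nbhs_nbhs (conj oK Kx)) => y; exact: K0.
Qed.

Lemma measurable_bdist_powR s :
  measurable_fun [set: 'rV[R]_d] (fun x => bdist Omega x `^ s).
Proof.
apply: (measurableT_comp (measurable_powR s)).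
exact: continuous_measurable_rV (continuous_edistance boundary_neq0).
Qed.

Lemma measurable_gradient_term s psi : C1 psi -> measurable_fun [set: 'rV[R]_d]
  (fun x => bdist Omega x `^ s * enorm (gradient psi x)).
Proof.
move=> [_ cg]; apply: measurable_funM; first exact: measurable_bdist_powR.
apply: continuous_measurable_rV => x.
by apply: continuous_comp; [exact: cg|exact: continuous_enorm].
Qed.

Lemma measurable_weight_term s psi : C1 psi -> measurable_fun [set: 'rV[R]_d]
  (fun x => bdist Omega x `^ s * psi x).
Proof.
move=> Cpsi; apply: measurable_funM; first exact: measurable_bdist_powR.
exact: continuous_measurable_rV (C1_continuous Cpsi).
Qed.

(** A negative power exchanges the roles of the two bounds, which are symmetric under inversion of
    k; hence the exponent [|s|] on k. *)
Lemma powR_comparable (k e t s : R) : 0 < k -> 0 < e ->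
  e / k <= t <= k * e -> t `^ s <= k `^ `|s| * e `^ s.
Proof.
move=> k0 e0 /andP[et te].
have ek0 : 0 < e / k by rewrite divr_gt0.
have t0 : 0 < t by exact: lt_le_trans et.
have [s0|s0] := leP 0 s.
  rewrite ger0_norm// -(powRM _ (ltW k0) (ltW e0)).
  by rewrite ge0_ler_powR ?nnegrE ?mulr_ge0 ?(ltW t0) ?(ltW k0) ?(ltW e0).
have sN0 : 0 <= - s by rewrite oppr_ge0 ltW.
have := ler_powRN sN0 ek0 et.
rewrite opprK ltr0_norm// => /le_trans; apply.
rewrite powRM ?invr_ge0 ?(ltW k0) ?(ltW e0)// mulrC -(powR_inv1 (ltW k0)) -powRrM.
by rewrite mulN1r.
Qed.

(** With D the smooth substitute for the distance on the support of phi, psi = D^a phi has the same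
    support, and lambda absorbs the error of replacing powers of D by powers of dist. *)
Lemma hardy_transfer (delta1 delta2 r lambda : R) phi : 1 < lambda ->
  Cc1 (boundary_layer Omega r) phi ->
  exists psi, [/\ Cc1 (boundary_layer Omega r) psi,
    phi <> cst 0 -> psi <> cst 0,
    (hardy_gradient_norm Omega delta1 psi <= lambda%:E *
      (hardy_gradient_norm Omega delta2 phi + `|(delta2 - delta1) / 2|%:E *
       hardy_weight_norm Omega delta2 phi))%E &
    (hardy_weight_norm Omega delta2 phi <=
      lambda%:E * hardy_weight_norm Omega delta1 psi)%E].
Proof.
move=> l1 [Cphi cK KO]; have [oO _] := domain_Omega.
have mO := open_measurable_rV oO.
set a := (delta2 - delta1) / 2.
have l0 : 0 < lambda by exact: lt_trans l1.
have a10 : 0 < `|a| + 1 by rewrite ltr_wpDl.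
(* The exponents a and a - 1 that occur have absolute value at most |a| + 1, so k^|s| <= lambda for
   each of them. *)
pose k := lambda `^ (`|a| + 1)^-1.
have k1 : 1 < k.
  have -> : 1 = 1 `^ (`|a| + 1)^-1 :> R by rewrite powR1.
  by rewrite gt0_ltr_powR ?invr_gt0 ?nnegrE// ltW.
have k0 : 0 < k by exact: lt_trans k1.
have kl (s : R) : `|s| <= `|a| + 1 -> k `^ `|s| <= lambda.
  move=> sa; rewrite -[leRHS](powRr1 (ltW l0)) -(mulVf (lt0r_neq0 a10)) powRrM.
  by rewrite ler_powR// ltW.
have [D [CD D0 gD DK]] : exists D : 'rV[R]_d -> R, [/\ C1 D, forall x, 0 < D x,
    forall x, enorm (gradient D x) <= 1 &
    forall x, csupport phi x ->
      bdist Omega x / k <= D x <= k * bdist Omega x].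
  by apply: regularized_distance => // x /KO[/bdist_gt0].
pose F x := D x `^ a.
have CF : C1 F by exact: C1_powR.
have F0 x : 0 < F x by exact: powR_gt0.
pose psi x := F x * phi x.
have Cpsi : C1 psi by exact: C1M.
have psi0 x : (psi x != 0) = (phi x != 0).
  by rewrite mulf_eq0 gt_eqF.
have Kpsi : csupport psi = csupport phi.
  by congr closure; apply/seteqP; split => x /=; rewrite psi0.
have gpsi x : enorm (gradient psi x) <=
    F x * enorm (gradient phi x) + `|a| * D x `^ (a - 1) * `|phi x|.
  have -> : gradient psi x = F x *: gradient phi x + phi x *: gradient F x.
    by apply: gradientM; [exact: CF.1|exact: Cphi.1].
  rewrite (le_trans (ler_enormD _ _))// !enormZ (gtr0_norm (F0 x)) lerD2l.
  rewrite gradient_powR//; last exact: CD.1.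
  rewrite enormZ normrM (ger0_norm (powR_ge0 _ _)) mulrC ler_wpM2r//.
  by rewrite ler_piMr// mulr_ge0// powR_ge0.
exists psi; split.
- by split=> //; rewrite Kpsi.
- move=> phin0 psin0; apply: phin0; apply/funext => x.
  by apply/eqP/contraT; rewrite /= -psi0 psin0/= eqxx.
- pose u x := bdist Omega x `^ (delta2 / 2) * enorm (gradient phi x).
  pose w x := bdist Omega x `^ (delta2 / 2 - 1) * phi x.
  pose v (x : 'rV[R]_d) : R := `|a| * `|w x|.
  have mu : measurable_fun [set: 'rV[R]_d] u by exact: measurable_gradient_term.
  have mw : measurable_fun [set: 'rV[R]_d] w by exact: measurable_weight_term.
  have mv : measurable_fun [set: 'rV[R]_d] v.
    by apply: measurable_funM => //; exact: measurableT_comp.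
  apply: (@le_trans _ _ (lambda%:E * L2norm Omega (u \+ v)%R)%E).
    apply: (L2norm_le mO (ltW l0) (measurable_funD mu mv)
                      (measurable_gradient_term _ Cpsi)).
    move=> x Ox; have e0 := bdist_gt0 Ox.
    have uv0 : 0 <= u x + v x.
      by rewrite addr_ge0// /u /v mulr_ge0// ?powR_ge0// enorm_ge0.
    rewrite ger0_norm ?mulr_ge0 ?powR_ge0 ?enorm_ge0//.
    rewrite -[(u \+ v) x]/(u x + v x) (ger0_norm uv0).
    (* D is known to be comparable with dist only on the support; elsewhere the gradient of psi is
       0. *)
    have [Kx|Kx] := pselect (csupport phi x); last first.
      have [_ ->] : psi x = 0 /\ gradient psi x = 0.
        by apply: notin_csupport; rewrite Kpsi.
      by rewrite enorm0 mulr0 mulr_ge0// ltW.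
    rewrite (le_trans (ler_wpM2l (powR_ge0 _ _) (gpsi x)))//.
    have wE : `|w x| = bdist Omega x `^ (delta2 / 2 - 1) * `|phi x|.
      by rewrite normrM (ger0_norm (powR_ge0 _ _)).
    rewrite /u /v wE.
    set e := bdist Omega x in e0 *.
    (* As a = delta2/2 - delta1/2, the weights for delta2 split off the factors dist^a and
       dist^(a-1). *)
    have -> : e `^ (delta2 / 2) = e `^ (delta1 / 2) * e `^ a.
      rewrite -powRD ?(gt_eqF e0) ?implybT//; congr (_ `^ _).
      by rewrite /a; field.
    have -> : e `^ (delta2 / 2 - 1) = e `^ (delta1 / 2) * e `^ (a - 1).
      rewrite -powRD ?(gt_eqF e0) ?implybT//; congr (_ `^ _).
      by rewrite /a; field.
    have Fe : F x <= lambda * e `^ a.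
      apply: le_trans (powR_comparable _ k0 e0 (DK x Kx)) _.
      by rewrite ler_wpM2r ?powR_ge0// kl// lerDl.
    have De : D x `^ (a - 1) <= lambda * e `^ (a - 1).
      apply: le_trans (powR_comparable _ k0 e0 (DK x Kx)) _.
      by rewrite ler_wpM2r ?powR_ge0// kl// (le_trans (ler_normB _ _))// normr1.
    have -> : lambda * (e `^ (delta1 / 2) * e `^ a * enorm (gradient phi x) +
          `|a| * (e `^ (delta1 / 2) * e `^ (a - 1) * `|phi x|)) =
        e `^ (delta1 / 2) * (lambda * e `^ a * enorm (gradient phi x) +
          `|a| * (lambda * e `^ (a - 1)) * `|phi x|) by ring.
    rewrite ler_wpM2l ?powR_ge0// lerD//.
      by rewrite ler_wpM2r ?enorm_ge0.
    by rewrite ler_wpM2r// ler_wpM2l.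
  rewrite lee_pmul2l ?lte_fin// (le_trans (L2normD mO mu mv))// leeD2l//.
  apply: L2norm_le => // x _.
  by rewrite /v normrM !normr_id.
- apply: L2norm_le => //; [exact: ltW|exact: measurable_weight_term| |].
    exact: measurable_weight_term.
  move=> x Ox; have e0 := bdist_gt0 Ox.
  have [Kx|Kx] := pselect (csupport phi x); last first.
    by have [-> _] := notin_csupport Kx; rewrite mulr0 normr0 mulr_ge0// ltW.
  rewrite /psi !normrM !(ger0_norm (powR_ge0 _ _)) -/(F x).
  set e := bdist Omega x in e0 *.
  have -> : e `^ (delta2 / 2 - 1) = e `^ (delta1 / 2 - 1) * e `^ a.
    rewrite -powRD ?(gt_eqF e0) ?implybT//; congr (_ `^ _).
    by rewrite /a; field.
  have eF : e `^ a <= lambda * F x.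
    (* Comparability is symmetric, so dist^a is in turn bounded by lambda D^a. *)
    have De : D x / k <= e <= k * D x.
      have /andP[eD De] := DK x Kx.
      by rewrite ler_pdivrMr// mulrC De/= mulrC -ler_pdivrMr.
    apply: le_trans (powR_comparable _ k0 (D0 x) De) _.
    by rewrite ler_wpM2r ?powR_ge0// kl// lerDl.
  rewrite [leRHS](_ : _ = e `^ (delta1 / 2 - 1) * (lambda * F x) * `|phi x|).
    by rewrite ler_wpM2r// ler_wpM2l ?powR_ge0.
  by ring.
Qed.

End hardy_transfer.

(** * Comparison of the Hardy constants for two exponents *)

Section hardy_constant.
Variables (R : realType) (d : nat) (Omega : set 'rV[R]_d).
Hypothesis domain_Omega : is_domain Omega.
Hypothesis boundary_neq0 : boundary Omega !=set0.
Implicit Types (psi : 'rV[R]_d -> R) (delta r : R).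
Local Open Scope ereal_scope.

Definition hardy_quotient delta psi : \bar R :=
  hardy_gradient_norm Omega delta psi / hardy_weight_norm Omega delta psi.

(** The inner infimum of [boundary_hardy_constant], isolated so that two exponents can be compared
    on the same layer. *)
Definition layer_hardy_constant delta r : \bar R :=
  ereal_inf [set hardy_quotient delta psi |
    psi in [set psi | Cc1 (boundary_layer Omega r) psi /\ psi <> cst 0%R]].

Lemma hardy_gradient_norm_ge0 delta psi : 0 <= hardy_gradient_norm Omega delta psi.
Proof. exact: L2norm_ge0. Qed.

Lemma hardy_weight_norm_ge0 delta psi : 0 <= hardy_weight_norm Omega delta psi.
Proof. exact: L2norm_ge0. Qed.

Lemma layer_hardy_constant_ge0 delta r : 0 <= layer_hardy_constant delta r.
Proof.
apply: le_ereal_inf_tmp => _ [psi _ <-].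
apply: mule_ge0; first exact: hardy_gradient_norm_ge0.
by rewrite inve_ge0; exact: hardy_weight_norm_ge0.
Qed.

Lemma boundary_hardy_constant_ge0 delta :
  0 <= boundary_hardy_constant Omega delta.
Proof.
apply: le_trans (layer_hardy_constant_ge0 delta 1) _.
by apply: ereal_sup_ubound; exists 1%R => //=.
Qed.

(* Holds also in the degenerate cases, where G / 0 is +oo for G > 0 and
   0 / 0 = G / +oo = 0. *)
Lemma ereal_quotient_le (l c : R) (G1 W1 G2 W2 : \bar R) :
  (0 < l)%R -> (0 <= c)%R -> 0 <= G1 -> 0 <= W1 -> 0 <= G2 -> 0 <= W2 ->
  G1 <= l%:E * (G2 + c%:E * W2) -> W2 <= l%:E * W1 ->
  G1 / W1 <= (l ^+ 2)%:E * (G2 / W2 + c%:E).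
Proof.
move=> l0 c0 G10 W10 G20 W20 G12 W21.
have l20 : (0 < l ^+ 2)%R by rewrite exprn_gt0.
have rhs0 : 0 <= (l ^+ 2)%:E * (G2 / W2 + c%:E).
  apply: mule_ge0; first by rewrite lee_fin ltW.
  by rewrite adde_ge0 ?lee_fin// mule_ge0 ?inve_ge0.
have [->|W1y] := eqVneq W1 +oo; first by rewrite invey mule0.
have [W2_0|W2_0] := eqVneq W2 0.
  have [G2_0|G2_0] := eqVneq G2 0.
    have -> : G1 = 0; last by rewrite mul0e.
    apply/eqP; rewrite eq_le G10 andbT (le_trans G12)//.
    by rewrite G2_0 W2_0 mule0 adde0 mule0.
  have pG2 : 0 < G2 by rewrite lt_def G2_0 G20.
  rewrite W2_0 inve0 (gt0_muley pG2) addye// gt0_muley ?lte_fin//; exact: leey.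
have W2y : W2 < +oo.
  by apply: (le_lt_trans W21); rewrite lte_mul_pinfty ?lee_fin ?(ltW l0)// ltey.
have [G2y|G2y] := eqVneq G2 +oo.
  have pW2 : 0 < W2^-1 by rewrite inve_gt0 ?lt_def ?W2_0 ?W20// -ltey.
  rewrite G2y (gt0_mulye pW2).
  rewrite addye// gt0_muley ?lte_fin//; exact: leey.
have G1y : G1 < +oo.
  apply: (le_lt_trans G12); rewrite lte_mul_pinfty ?lee_fin ?(ltW l0)//.
  apply: lte_add_pinfty; first by rewrite ltey.
  by apply: lte_mul_pinfty; rewrite ?lee_fin.
have W1_0 : W1 != 0.
  apply: contraTneq W21 => ->; rewrite mule0 -ltNge lt_def W2_0 W20//.
move: G1 W1 G2 W2 {rhs0} G10 W10 G20 W20 G12 W21 W1y W2_0 G2y W2y G1y W1_0.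
move=> [g1| |] [w1| |] [g2| |] [w2| |]//.
rewrite !lee_fin => g10 w10 g20 w20 + + _ + _ _ _.
rewrite !eqe => g12 w21 w2_0 w1_0.
rewrite !inver (negbTE w1_0) (negbTE w2_0) lee_fin.
have pw1 : (0 < w1)%R by rewrite lt_def w1_0.
have pw2 : (0 < w2)%R by rewrite lt_def w2_0.
rewrite ler_pdivrMr// (le_trans g12)//.
(* The last factor l w1 / w2 is at least 1; the remaining product is the bound on g1. *)
have -> : (l ^+ 2 * (g2 / w2 + c) * w1 =
  l * (g2 + c * w2) * (l * w1 / w2))%R by field.
rewrite ler_peMr// ?mulr_ge0 ?addr_ge0 ?mulr_ge0 ?(ltW l0)//.
by rewrite ler_pdivlMr// mul1r.
Qed.

(** Each test function for delta2 is transferred to delta1 at the cost of a factor lambda^2 in the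
    quotient, and lambda can be taken arbitrarily close to 1. *)
Lemma layer_hardy_constant_le delta1 delta2 r :
  layer_hardy_constant delta1 r <=
  layer_hardy_constant delta2 r + `|(delta2 - delta1) / 2|%:E.
Proof.
set c := `|_|%R; rewrite -leeBlDr//.
apply: le_ereal_inf_tmp => _ [phi [Cphi phi0] <-].
(* The limit is replaced by the inequality with a factor t on the left for all t in (0,1), which
   corresponds to lambda = t^(-1/2). *)
rewrite leeBlDr//; apply/lee_mul01Pr; first exact: layer_hardy_constant_ge0.
move=> t /andP[t0 t1].
pose l := Num.sqrt t^-1.
have l2 : (l ^+ 2 = t^-1)%R by rewrite sqr_sqrtr// invr_ge0 ltW.
have l1 : (1 < l)%R.
  by rewrite -(@ltr_pXn2r _ 2) ?nnegrE ?sqrtr_ge0// expr1n l2 invf_gt1.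
have l0 : (0 < l)%R by exact: lt_trans l1.
have [psi [Cpsi psi0 Gpsi Wpsi]] :=
  hardy_transfer domain_Omega boundary_neq0 delta1 delta2 l1 Cphi.
rewrite -lee_pdivlMl// -l2.
apply: (@le_trans _ _ (hardy_quotient delta1 psi)).
  by apply: ereal_inf_lbound; exists psi => //; split=> //; exact: psi0.
exact: (ereal_quotient_le l0 (normr_ge0 _)
  (hardy_gradient_norm_ge0 _ _) (hardy_weight_norm_ge0 _ _)
  (hardy_gradient_norm_ge0 _ _) (hardy_weight_norm_ge0 _ _) Gpsi Wpsi).
Qed.

(** The error in the layerwise estimate is independent of r and so survives the supremum over r. *)
Lemma boundary_hardy_constant_le delta1 delta2 :
  boundary_hardy_constant Omega delta1 <=
  boundary_hardy_constant Omega delta2 + `|(delta2 - delta1) / 2|%:E.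
Proof.
apply: ge_ereal_sup => _ [r r0 <-].
apply: (le_trans (layer_hardy_constant_le delta1 delta2 r)).
rewrite leeD2r//; apply: ereal_sup_ubound.
by exists r.
Qed.

End hardy_constant.

(** * The derivative of a squared positive part *)

Section bump.
Variables (R : realType) (b : R).

(** The remainder of the first-order expansion is at most u^2 for every combination of signs, so the
    kink at t = b causes no special case. *)
Lemma is_derive_sqr_pos_part (t : R) :
  is_derive t 1 (fun t => Num.max 0 (b - t) ^+ 2) (-2 * Num.max 0 (b - t)).
Proof.
set h := fun t => _; set g := -2 * _.
have bound u : `|h (u + t) - h t - u * g| <= u ^+ 2.
  rewrite /h /g ler_norml; case: (leP 0 (b - t)); case: (leP 0 (b - (u + t))) => *;
  by apply/andP; split; nra.
have hg : (fun u => u^-1 *: ((h \o shift t) (u *: 1) - h t)) @ 0^' --> g.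
  apply/cvgrPdist_le => e e0; near=> u.
  have u0 : u != 0 by near: u; exact: nbhs_dnbhs_neq.
  have -> : g - u^-1 *: ((h \o shift t) (u *: 1) - h t) =
      - (u^-1 * (h (u + t) - h t - u * g)).
    by rewrite /= /GRing.scale/= mulr1; field.
  rewrite normrN normrM normfV.
  rewrite ler_pdivrMl ?normr_gt0//.
  apply: le_trans (bound u) _; rewrite -normr_id -real_normK ?num_real// expr2.
  rewrite normr_id ler_wpM2l//.
  near: u; apply: nbhs_dnbhs; apply/nbhs_ballP; exists e => //= u.
  by rewrite /ball/= sub0r normrN => /ltW.
split; first by apply/cvg_ex; exists g.
exact: cvg_lim hg.
Unshelve. all: by end_near. Qed.

End bump.

(** * Finiteness of b_2 by scaled bumps *)

Section boundary_hardy_constant_finite.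
Variables (R : realType) (d : nat) (Omega : set 'rV[R]_d).
Hypothesis domain_Omega : is_domain Omega.
Hypothesis boundary_neq0 : boundary Omega !=set0.

(** The segment from c to x stays closer to c than the boundary does, hence misses it; Omega is then
    both open and closed relative to the connected segment. *)
Lemma eball_sub_domain c x : Omega c -> enorm (x - c) < bdist Omega c -> Omega x.
Proof.
have [oO _] := domain_Omega => Oc xc.
pose f (t : R) : 'rV[R]_d := c + t *: (x - c).
have cf : continuous f.
  move=> t; apply: differentiable_continuous.
  apply: differentiableD; first exact: differentiable_cst.
  apply: differentiableZl; exact: ex_diff.
have cA : connected (f @` `[0, 1]).
  apply: connected_continuous_connected; first exact: segment_connected.
  exact: continuous_subspaceT.
have fO t : t \in `[0, 1] -> ~ boundary Omega (f t).
  rewrite in_itv/= => /andP[t0 t1] bt; have := edistance_le boundary_neq0 c bt.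
  rewrite leNgt => /negP; apply; apply: le_lt_trans xc.
  rewrite /f opprD addNKr enormN enormZ ger0_norm//.
  by rewrite ler_piMl// enorm_ge0.
have AO : f @` `[0, 1] `&` Omega = f @` `[0, 1].
  apply: cA.
  - exists c; split => //; exists 0; first by rewrite /= in_itv/= lexx ler01.
    by rewrite /f scale0r addr0.
  - by exists Omega.
  - exists (closure Omega); first exact: closed_closure.
    apply/seteqP; split => y [Ay Oy]; split=> //; first exact: subset_closure.
    apply: contrapT => Ny; case: Ay Oy Ny => t t01 <- Oy Ny.
    apply: (fO t t01); split => // /interior_subset; exact: Ny.
suff : (f @` `[0, 1] `&` Omega) x by case.
rewrite AO; exists 1; first by rewrite /= in_itv/= lexx ler01.
by rewrite /f scale1r addrC subrK.
Qed.

(** The closed sup-norm ball, written by coordinates so that its measure is a product. *)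
Definition closed_box (c : 'rV[R]_d) (t : R) : set 'rV[R]_d :=
  [set x | forall i, `[c ord0 i - t, c ord0 i + t]%classic (x ord0 i)].

Lemma measurable_closed_box c t : measurable (closed_box c t).
Proof.
by apply: (@measurable_box R d (fun i => `[c ord0 i - t, c ord0 i + t]%classic)) => i;
   exact: measurable_itv.
Qed.

Lemma lebesgue_closed_box c t : 0 <= t ->
  lebesgue_rV R d (closed_box c t) = ((2 * t) ^+ d)%:E.
Proof.
move=> t0; rewrite (@lebesgue_rV_box R d (fun i => `[c ord0 i - t, c ord0 i + t]%classic)).
  under eq_bigr do rewrite lebesgue_measure_itv/= lte_fin.
  have -> : ((2 * t) ^+ d)%:E = (\prod_(i < d) (2 * t)%:E)%E.
    by rewrite prodEFin prodr_const card_ord.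
  apply: eq_bigr => i _.
  case: ltP => [_|]; first by rewrite -EFinB; congr EFin; ring.
  by move=> h; congr EFin; lra.
by move=> i; exact: measurable_itv.
Qed.

Lemma L2norm_indic_closed_box c t : 0 <= t -> closed_box c t `<=` Omega ->
  L2norm Omega \1_(closed_box c t) = (((2 * t) ^+ d) `^ 2^-1)%:E.
Proof.
move=> t0 BO; rewrite /L2norm unlock -poweR_EFin -(lebesgue_closed_box c t0).
congr (_ `^ _)%E.
rewrite -(setIT (closed_box c t)) -integral_indic//; last exact: measurable_closed_box.
apply: eq_integral => x _ /=; rewrite patchE setIT.
case: ifPn => [_|xO]; rewrite indicE.
  by case: (x \in _); rewrite ?normr1 ?normr0 ?powR1 ?powR0.
rewrite normr0 powR0//; case: (boolP (x \in closed_box c t)) => // /[!inE] /BO.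
by move=> Ox; case/negP: xO; rewrite inE.
Qed.

(** Squaring the positive part makes the function C^1 across the sphere |x - c| = s, and the squared
    norm keeps it smooth at c. *)
Definition bump c s : 'rV[R]_d -> R :=
  fun x => Num.max 0 (s ^+ 2 - enorm (x - c) ^+ 2) ^+ 2.

Lemma bump_gradient c s x : gradient (bump c s) x =
  - (4 * Num.max 0 (s ^+ 2 - enorm (x - c) ^+ 2)) *: (x - c).
Proof.
have [dn gn] := gradient_sqr_enorm c x.
have := gradient_comp dn (is_derive_sqr_pos_part (s ^+ 2) _).
move=> [_].
rewrite /bump /comp => ->.
by rewrite gn scalerA; congr (_ *: _); ring.
Qed.

Lemma C1_bump c s : C1 (bump c s).
Proof.
apply: (C1_comp (h := fun t => Num.max 0 (s ^+ 2 - t) ^+ 2)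
  (h' := fun t => -2 * Num.max 0 (s ^+ 2 - t)) (C1_sqr_enorm c)).
  by move=> x; exact: is_derive_sqr_pos_part.
move=> x; set t := enorm _ ^+ 2.
have cg : {for t, continuous (fun t : R => s ^+ 2 - t)}.
  apply: differentiable_continuous; apply: differentiableB.
    exact: differentiable_cst.
  exact: ex_diff.
have c0 : {for t, continuous (cst 0 : R -> R)} by exact: cst_continuous.
have cm : Num.max 0 (s ^+ 2 - u) @[u --> t] --> Num.max 0 (s ^+ 2 - t).
  exact: (continuous_max c0 cg).
by apply: (cvgM (cvg_cst (-2 : R) (F := nbhs t)) cm).
Qed.

Lemma bump_out c s x : 0 <= s -> s <= enorm (x - c) -> bump c s x = 0.
Proof.
move=> s0 sx; rewrite /bump max_l ?expr0n// subr_le0.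
by rewrite ler_pXn2r ?nnegrE// enorm_ge0.
Qed.

Lemma csupport_bump c s : 0 <= s ->
  csupport (bump c s) `<=` [set x | enorm (x - c) <= s].
Proof.
move=> s0; have cE : closed [set x | enorm (x - c) <= s].
  rewrite (_ : mkset _ = ~` [set x | s < enorm (x - c)]).
    apply: open_closedC; apply: open_lt_fun; first exact: cst_continuous.
    apply: enorm_lipschitz_continuous => x y.
    by rewrite [leRHS]addrC enorm_distD.
  by apply/seteqP; split => x /=; rewrite leNgt => /negP.
move=> x /(closureS (B := [set x | enorm (x - c) <= s])).
rewrite -(proj1 (closure_id _) cE); apply => y /= by0.
by rewrite leNgt; apply: contra by0 => /ltW sy; rewrite bump_out.
Qed.

Lemma enorm_le_coord (x : 'rV[R]_d) (t : R) : 0 <= t ->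
  (forall i, `|x ord0 i| <= t) -> enorm x <= d.+1%:R * t.
Proof.
move=> t0 xt; rewrite (le_trans (enorm_ler_norm x))//.
have xt' : `|x| <= t.
  have [->|x0] := eqVneq x 0; first by rewrite normr0.
  have /mx_norm_neq0[[i j] /= xE] : mx_norm x != 0.
    by rewrite -[mx_norm _]/`|x| normr_eq0.
  by rewrite -[`|x|]/(mx_norm x) xE ord1.
by rewrite ler_pM// ler_nat.
Qed.

Lemma closed_box_enorm c t x : 0 <= t -> closed_box c t x ->
  enorm (x - c) <= d.+1%:R * t.
Proof.
move=> t0 Bx; apply: enorm_le_coord => // i; have := Bx i.
by rewrite /= in_itv/= !mxE ler_distl.
Qed.

(* The sup-norm box of half-side s lies in the Euclidean ball of radius
   dist(c) / 2, the box of half-side s / (2 n) in that of radius s / 2. *)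
Lemma bump_quotient_le (n s : R) c : Omega c -> n = d.+1%:R ->
  s = bdist Omega c / (2 * n) ->
  (hardy_quotient Omega 2 (bump c s) <=
   (12 * n * (((2 * n) ^+ d) `^ 2^-1) * (16 / 9))%:E)%E.
Proof.
move=> Oc nE sE; have [oO _] := domain_Omega.
have mO := open_measurable_rV oO.
have rho0 := bdist_gt0 domain_Omega boundary_neq0 Oc.
have n1 : 1 <= n by rewrite nE ler1n.
have n0 : 0 < n by exact: lt_le_trans n1.
have rhoE : bdist Omega c = 2 * n * s by rewrite sE; field; rewrite gt_eqF.
have s0 : 0 < s by rewrite sE divr_gt0// mulr_gt0.
have t0 : 0 < s / (2 * n) by rewrite divr_gt0// mulr_gt0.
have B1O : closed_box c s `<=` Omega.
  move=> x /(closed_box_enorm (ltW s0)) xc; apply: (eball_sub_domain Oc).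
  by rewrite (le_lt_trans xc)// -nE rhoE; nra.
have B2s x : closed_box c (s / (2 * n)) x -> enorm (x - c) <= s / 2.
  move=> /(closed_box_enorm (ltW t0)) /le_trans; apply.
  by rewrite -nE le_eqVlt; apply/orP; left; apply/eqP; field; rewrite gt_eqF.
have B2O : closed_box c (s / (2 * n)) `<=` Omega.
  move=> x /B2s xc; apply: (eball_sub_domain Oc).
  by rewrite (le_lt_trans xc)// rhoE; nra.
(* The square root of the volume ratio of the two boxes, whose half-sides differ by the factor
   2n. *)
set K := ((2 * n) ^+ d) `^ 2^-1.
set l2 := ((2 * (s / (2 * n))) ^+ d) `^ 2^-1.
have l20 : 0 < l2 by rewrite powR_gt0// exprn_gt0// mulr_gt0.
have mbox t : measurable_fun [set: 'rV[R]_d] (\1_(closed_box c t) : _ -> R).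
  by apply: measurable_indic; exact: measurable_closed_box.
(* For delta = 2 the gradient carries the weight dist. Where the bump is nonzero, dist <= 2ns + s <=
   3ns and the gradient has length at most 4 s^3. *)
have G_le : (hardy_gradient_norm Omega 2 (bump c s) <=
    (12 * n * s ^+ 4)%:E * (K * l2)%:E)%E.
  have -> : K * l2 = ((2 * s) ^+ d) `^ 2^-1.
    have p1 : 0 <= (2 * n) ^+ d by rewrite exprn_ge0// mulr_ge0// ltW.
    have p2 : 0 <= (2 * (s / (2 * n))) ^+ d by rewrite exprn_ge0// mulr_ge0// ltW.
    rewrite -(powRM _ p1 p2) -exprMn.
    by congr ((_ ^+ _) `^ _); field; rewrite gt_eqF.
  rewrite -(L2norm_indic_closed_box (ltW s0) B1O).
  have k0 : 0 <= 12 * n * s ^+ 4.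
    by rewrite !mulr_ge0 ?exprn_ge0 ?(ltW s0) ?(ltW n0).
  apply: (L2norm_le mO k0 (mbox s)
    (measurable_gradient_term boundary_neq0 _ (C1_bump c s))).
  move=> x Ox; rewrite divff// powRr1 ?edistance_ge0//.
  rewrite ger0_norm ?mulr_ge0 ?edistance_ge0 ?enorm_ge0//.
  rewrite bump_gradient enormZ.
  have [xs|sx] := ltP (enorm (x - c)) s; last first.
    rewrite max_l; last by rewrite subr_le0 ler_pXn2r ?nnegrE ?enorm_ge0 ?(ltW s0).
    by rewrite mulr0 oppr0 normr0 mul0r mulr0 mulr_ge0.
  have Bx : closed_box c s x.
    move=> i; rewrite /= in_itv/= -ler_distl.
    have := ler_coord_enorm (x - c) i; rewrite !mxE => /le_trans; apply.
    exact: ltW.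
  rewrite indicE mem_set//= normr1 mulr1.
  have dx : bdist Omega x <= 3 * n * s.
    rewrite (le_trans (edistance_lipschitz boundary_neq0 x c))//.
    by rewrite -/(bdist Omega c) rhoE; nra.
  set m := Num.max _ _.
  have m0 : 0 <= m by rewrite le_max lexx.
  have ms : m <= s ^+ 2 by rewrite ge_max sqr_ge0 gerBl sqr_ge0.
  rewrite normrN normrM (ger0_norm m0) ger0_norm//.
  rewrite (_ : 12 * n * s ^+ 4 = 3 * n * s * (4 * s ^+ 2 * s)); last by ring.
  apply: ler_pM => //; rewrite ?edistance_ge0 ?mulr_ge0 ?enorm_ge0//.
  apply: ler_pM => //; rewrite ?enorm_ge0 ?mulr_ge0// ?(ltW xs)//.
  by rewrite ler_wpM2l.
(* The other weight is dist^0. On the smaller box |x - c| <= s/2, so the bump is at least (3 s^2 /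
   4)^2 = 9 s^4 / 16. *)
have W_ge : (l2%:E <= (16 / 9 / s ^+ 4)%:E *
    hardy_weight_norm Omega 2 (bump c s))%E.
  rewrite -(L2norm_indic_closed_box (ltW t0) B2O).
  have k0 : 0 <= 16 / 9 / s ^+ 4.
    by rewrite !mulr_ge0 ?invr_ge0 ?exprn_ge0 ?(ltW s0).
  apply: (L2norm_le mO k0
    (measurable_weight_term boundary_neq0 _ (C1_bump c s)) (mbox (s / (2 * n)))).
  move=> x Ox; rewrite divff// subrr powRr0 mul1r indicE.
  case: (boolP (x \in _)) => [|_]; last first.
    by rewrite normr0 mulr_ge0.
  rewrite inE => /B2s xs; rewrite normr1 ger0_norm ?sqr_ge0//.
  have h : enorm (x - c) ^+ 2 <= (s / 2) ^+ 2.
    by rewrite ler_pXn2r ?nnegrE ?enorm_ge0// divr_ge0 ?(ltW s0).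
  have h2 : 3 / 4 * s ^+ 2 <= Num.max 0 (s ^+ 2 - enorm (x - c) ^+ 2).
    by rewrite le_max; apply/orP; right; lra.
  have h3 : (3 / 4 * s ^+ 2) ^+ 2 <= bump c s x.
    have q0 : 0 <= 3 / 4 * s ^+ 2 by rewrite mulr_ge0 ?sqr_ge0.
    by rewrite ler_pXn2r// nnegrE (le_trans q0 h2).
  apply: (@le_trans _ _ (16 / 9 / s ^+ 4 * (3 / 4 * s ^+ 2) ^+ 2)).
    by rewrite le_eqVlt; apply/orP; left; apply/eqP; field; rewrite gt_eqF.
  by rewrite ler_wpM2l.
rewrite /hardy_quotient.
have := hardy_weight_norm_ge0 Omega 2 (bump c s).
move: (hardy_weight_norm _ _ _) (hardy_gradient_norm _ _ _) W_ge G_le.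
(* An infinite weight norm makes the quotient 0. *)
move=> [w||] // G W_ge G_le w0; last first.
  by rewrite invey mule0 lee_fin !mulr_ge0 ?powR_ge0// ltW.
have {}W_ge : l2 <= 16 / 9 / s ^+ 4 * w by [].
have pw : 0 < w.
  rewrite lt_def -lee_fin w0 andbT; apply: contraTneq W_ge => ->.
  by rewrite mulr0 -ltNge.
rewrite inver gt_eqF// lee_pdivrMr// (le_trans G_le)// -EFinM lee_fin.
apply: (@le_trans _ _ (12 * n * s ^+ 4 * (K * (16 / 9 / s ^+ 4 * w)))).
  rewrite ler_wpM2l ?ler_wpM2l ?powR_ge0//.
  by rewrite !mulr_ge0 ?exprn_ge0 ?(ltW s0) ?(ltW n0).
by rewrite le_eqVlt; apply/orP; left; apply/eqP; field; rewrite gt_eqF.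
Qed.

(** The bound on the quotient of a bump depends only on d, and every layer, however thin, contains
    the support of such a bump. *)
Lemma boundary_hardy_constant2_lty : (boundary_hardy_constant Omega 2 < +oo)%E.
Proof.
set n : R := d.+1%:R.
have n1 : 1 <= n by rewrite ler1n.
have n0 : 0 < n by exact: lt_le_trans n1.
apply: (@le_lt_trans _ _
  (12 * n * (((2 * n) ^+ d) `^ 2^-1) * (16 / 9))%:E); last exact: ltry.
apply: ge_ereal_sup => _ [r /= r0 <-].
have [y [cy Ny]] := boundary_neq0.
(* In the Euclidean norm the radius r/(2n) gives dist(c) <= r/2; since s <= dist(c)/2, points of the
   support have distance at most 3r/4 to the boundary. *)
have [c [Oc yc]] := cy _ (nbhsx_ballx y (r / (2 * n)) (divr_gt0 r0 (mulr_gt0 (ltr0Sn R 1) n0))).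
have rho0 := bdist_gt0 domain_Omega boundary_neq0 Oc.
set s := bdist Omega c / (2 * n).
have s0 : 0 < s by rewrite divr_gt0// mulr_gt0.
have rhoE : bdist Omega c = 2 * n * s by rewrite /s; field; rewrite gt_eqF.
have cr : bdist Omega c <= r / 2.
  rewrite (le_trans (edistance_le boundary_neq0 c (conj cy Ny)))//.
  have yc' : `|c - y| <= r / (2 * n).
    by apply: ltW; move: yc; rewrite -ball_normE /ball_/= distrC.
  rewrite (le_trans (enorm_ler_norm _))//.
  apply: (@le_trans _ _ (n * (r / (2 * n)))).
    by rewrite ler_pM// ler_nat.
  by rewrite le_eqVlt; apply/orP; left; apply/eqP; field; rewrite gt_eqF.
apply: ge_ereal_inf; exists (hardy_quotient Omega 2 (bump c s)); last first.
  exact: bump_quotient_le.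
exists (bump c s) => //; split; last first.
  move=> /(congr1 (@^~ c)); rewrite /bump subrr enorm0 expr0n/= subr0.
  rewrite max_r ?sqr_ge0// => /eqP.
  by rewrite !expf_eq0/= gt_eqF.
have sub := csupport_bump (ltW s0).
split; first exact: C1_bump.
  apply: bounded_closed_compact; last exact: closed_closure.
  exists (enorm c + s); split; first exact: num_real.
  move=> M cM x /sub /= xc; rewrite (le_trans (ler_norm_enorm x))//.
  rewrite (le_trans _ (ltW cM))// -{1}[x](subrK c) addrC.
  by rewrite (le_trans (ler_enormD _ _))// lerD2l.
move=> x /sub /= xc; split.
  by apply: (eball_sub_domain Oc); rewrite (le_lt_trans xc)// rhoE; nra.
rewrite (le_lt_trans (edistance_lipschitz boundary_neq0 x c))//.
by rewrite -/(bdist Omega c); nra.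
Qed.

End boundary_hardy_constant_finite.

(** * Deduction of I, II and III from the comparison of constants and the finiteness of b_2 *)

Theorem proposition6p6 (R : realType) (d : nat) (Omega : set 'rV[R]_d)
    (domain_Omega : is_domain Omega)
    (boundary_neq0 : boundary Omega !=set0)
    (r : R) (r_gt0 : 0 < r)
    (hardy : forall delta, hardy_range Omega delta ->
      exists2 b : R, 0 < b & hardy_inequality Omega delta r b) :
  let dH := hausdorff_dim (boundary Omega) in
  let inI := hardy_range Omega in
  let b := boundary_hardy_constant Omega in
  [/\ (forall delta1 delta2 : R, inI delta1 -> inI delta2 ->
         (delta1 <= delta2)%R ->
         b delta1 + (delta1 / 2)%R%:E <= b delta2 + (delta2 / 2)%R%:E)%E
      /\ (forall delta : R, inI delta ->
         b 2%R >= b delta - ((2 - delta) / 2)%R%:E)%E,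
      (b 2%R >= (d%:R%:E - dH) / 2%:E ->
       forall delta : R, inI delta ->
         `|b 2%R - b delta| <= ((2 - delta) / 2)%R%:E)%E
    & (b 2%R >= (d%:R%:E - dH) / 2%:E ->
       (forall delta : R, inI delta ->
          b delta <= (d%:R%:E - dH + delta%:E - 2%:E) / 2%:E) ->
       forall delta : R, inI delta ->
         b delta = b 2%R - ((2 - delta) / 2)%R%:E)%E].
Proof.
move=> dH inI b.
have b_le d1 d2 : (b d1 <= b d2 + `|(d2 - d1) / 2|%:E)%E.
  exact: boundary_hardy_constant_le.
(* All constants are finite because b_2 is, so the claims reduce to linear inequalities between
   reals. *)
have [f fE] : exists f : R -> R, forall delta, b delta = (f delta)%:E.
  exists (fun delta => fine (b delta)) => delta; rewrite fineK//.
  rewrite ge0_fin_numE; last exact: boundary_hardy_constant_ge0.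
  apply: le_lt_trans (b_le delta 2) _; apply: lte_add_pinfty; last exact: ltry.
  exact: boundary_hardy_constant2_lty.
have f_le d1 d2 : f d1 <= f d2 + `|(d2 - d1) / 2|.
  by have := b_le d1 d2; rewrite !fE -EFinD lee_fin.
have I2 delta : inI delta -> delta <= 2.
  by move=> /andP[_]; rewrite lee_fin.
have abs1 (delta : R) : delta <= 2 -> `|(2 - delta) / 2| = (2 - delta) / 2.
  by move=> d2; rewrite ger0_norm ?divr_ge0 ?subr_ge0.
have abs2 (delta : R) : delta <= 2 -> `|(delta - 2) / 2| = (2 - delta) / 2.
  by move=> d2; rewrite -normrN -mulNr opprB abs1.
split.
- split=> [d1 d2 _ _ d12|delta /I2 d2]; rewrite !fE lee_fin.
    have := f_le d1 d2.
    by rewrite ger0_norm ?divr_ge0 ?subr_ge0//; lra.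
  have := f_le delta 2; rewrite abs1// => h.
  by lra.
- move=> _ delta /I2 d2; rewrite !fE -EFinB lee_fin.
  have := f_le delta 2; have := f_le 2 delta.
  rewrite abs1// abs2// => h1 h2.
  by rewrite ler_norml; apply/andP; split; lra.
(* One inequality is the comparison of b_2 with b_delta; the other is b_delta <= (d - d_H)/2 - (2 -
   delta)/2 <= b_2 - (2 - delta)/2. *)
- move=> b2_ge b_up delta Id; have d2 := I2 _ Id.
  have inI2 : inI 2.
    by move: Id => /andP[/lt_le_trans h d2']; apply/andP; split=> //; exact: h.
  move: (b_up _ Id) (b_up _ inI2) b2_ge (Id) => {b_up}.
  have inv2 : (2%:E^-1 = 2^-1%:E :> \bar R)%E by rewrite inver pnatr_eq0.
  rewrite !fE /inI /hardy_range /= -/dH !inv2.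
  (* Only a finite d_H remains: for +oo the interval I is empty, and for -oo the lower bound on b_2
     would be infinite. *)
  case: dH => [h| |]; last 2 first.
  + by move=> _ _ _ /andP[].
  + by move=> _ _; rewrite gt0_mulye// lte_fin.
  rewrite /= !lee_fin => h1 h2 h3 _; have := f_le 2 delta.
  rewrite abs2// => h4.
  by congr EFin; lra.
Qed.
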